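(* Let $r$ be a real number with $0<|r|<1$. Define $f_r(x):=\sum_{n=1}^\infty r^n\varphi^{(n)}(x)$ and $f_{r,N}(x):=\sum_{n=1}^{N-1}r^n\varphi^{(n)}(x)$ for $x\in[0,1]$, $N=1,2,\dots$. Then: (i) there is a nondegenerate random variable (i.e. a nonconstant Borel measurable function) $L_r$ on $[0,1]$ with $\int_0^1 L_r(x)\,dx=1$ such that $$\frac{f_r(x)-f_{r,N}(x)}{\frac12\sum_{n=N}^\infty r^n}\to L_r(x)\quad\text{in distribution as } N\to\infty$$ (with respect to Lebesgue measure on $[0,1]$); (ii) $$\lim_{N'\to\infty}\frac1{N'}\sum_{N=1}^{N'}\frac{f_r(x)-f_{r,N}(x)}{\frac12\sum_{n=N}^\infty r^n}=1$$ for Lebesgue-a.e. $x\in[0,1]$ and in $L^1([0,1])$.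
   Context: The tent map on $[0,1]$ is $\varphi(x)=2x$ for $x\in[0,1/2]$ and $\varphi(x)=2(1-x)$ for $x\in[1/2,1]$; it is extended to $\mathbb{R}$ by $\varphi(x):=\varphi(x-[x])$, and $\varphi^{(n)}$ denotes the $n$-fold iterate of $\varphi$, so that $\varphi^{(n)}(x)=\varphi(2^{n-1}x)$. *)

(* Defs.v *)
From HB Require Import structures.
From mathcomp Require Import all_boot all_order all_algebra.
From mathcomp Require Import all_classical all_reals all_analysis.
Set Implicit Arguments. Unset Strict Implicit. Unset Printing Implicit Defensive.
Import Order.TTheory GRing.Theory Num.Theory.
Import numFieldNormedType.Exports.
Local Open Scope classical_set_scope.
Local Open Scope ring_scope.

Definition I01 (R : realType) : set R := `[0%R, 1%R]%classic.
Arguments I01 R : clear implicits.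

Definition tent {R : realType} (x : R) : R :=
  let y := x - (Num.floor x)%:~R in
  if y <= 2^-1 then 2 * y else 2 * (1 - y).

Definition tent_iter {R : realType} (n : nat) (x : R) : R := iter n tent x.

Definition f_partial {R : realType} (r : R) (N : nat) (x : R) : R :=
  \sum_(1 <= n < N) r ^+ n * tent_iter n x.

Definition f_full {R : realType} (r : R) (x : R) : R :=
  \big[+%R/0%R]_(1 <= n <oo) (r ^+ n * tent_iter n x).

Definition normalized_tail {R : realType} (r : R) (N : nat) (x : R) : R :=
  (f_full r x - f_partial r N x) /
    (2^-1 * \big[+%R/0%R]_(N <= n <oo) (r ^+ n)).

Definition cdf01 {R : realType} (g : R -> R) (t : R) : R :=
  fine ((@lebesgue_measure R) (I01 R `&` [set x | g x <= t])).

Definition cvg_in_distribution01 {R : realType} (X : nat -> R -> R) (L : R -> R)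
  : Prop :=
  forall t : R, {for t, continuous (cdf01 L)} ->
    cdf01 (X N) t @[N --> \oo] --> cdf01 L t.

Definition cesaro_tail {R : realType} (r : R) (N' : nat) (x : R) : R :=
  N'%:R^-1 * \sum_(1 <= N < N'.+1) normalized_tail r N x.

(* Main.v *)
(** With [L y = 2 (1 - r) \sum_k r^k tent^k y], the normalized tail is
    [L \o tent^N], and [L y = 2 (1 - r) y + r L (tent y)].  Since the tent map
    preserves Lebesgue measure on [0, 1], all normalized tails with [N > 0] have
    the law of [L], the functional equation gives mean 1, and [L = c] a.e. would
    force [y = c / 2] a.e.

    For the averages, no ergodic theorem is needed: the tent map is symmetric
    under [x |-> 1 - x] while [x - 1/2] is antisymmetric, so the functions
    [tent^n - 1/2] are orthogonal.  Their averages along the squares are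
    square-summable in mean, hence tend to 0 a.e., and boundedness fills the
    gaps between consecutive squares.  Summing the functional equation along an
    orbit telescopes and transfers this to [L]; dominated convergence yields
    the convergence in L^1. *)
Require Import Defs.
From HB Require Import structures.
From mathcomp Require Import all_boot all_order all_algebra.
From mathcomp Require Import all_classical all_reals all_analysis.
From mathcomp Require Import measurable_realfun zify ring lra.
Set Implicit Arguments. Unset Strict Implicit. Unset Printing Implicit Defensive.
Import Order.TTheory GRing.Theory Num.Theory.
Import numFieldNormedType.Exports.
Local Open Scope classical_set_scope.
Local Open Scope ring_scope.

(** * Affine images of Lebesgue measure and integration under measure-preserving maps *)

Lemma preimage_affine_itv_pos (R : realType) (a b p q : R) : 0 < a ->
  (fun x => a * x + b) @^-1` `]p, q] = `](p - b) / a, (q - b) / a]%classic.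
Proof.
move=> a0; apply/seteqP; split => x /=; rewrite !in_itv/= ltr_pdivrMr// ler_pdivlMr//.
- by move=> /andP[? ?]; apply/andP; split; lra.
- by move=> /andP[? ?]; apply/andP; split; lra.
Qed.

Lemma preimage_affine_itv_neg (R : realType) (a b p q : R) : a < 0 ->
  (fun x => a * x + b) @^-1` `]p, q] = `[(q - b) / a, (p - b) / a[%classic.
Proof.
move=> a0; apply/seteqP; split => x /=; rewrite !in_itv/= ltr_ndivlMr// ler_ndivrMr//.
- by move=> /andP[? ?]; apply/andP; split; lra.
- by move=> /andP[? ?]; apply/andP; split; lra.
Qed.

Lemma measurable_affine (R : realType) (a b : R) :
  measurable_fun [set: R] (fun x : R => a * x + b).
Proof. by apply: measurable_funD => //; exact: measurable_funM. Qed.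

(** Uniqueness of Lebesgue measure: [|a|] times its pushforward under the affine map agrees with it
    on the half-open intervals. *)
Lemma lebesgue_measure_affine (R : realType) (a b : R) (A : set R) : a != 0 ->
  measurable A ->
  (@lebesgue_measure R) ((fun x => a * x + b) @^-1` A) =
  ((`|a|^-1)%:E * (@lebesgue_measure R) A)%E.
Proof.
move=> a0 mA.
have na0 : `|a| != 0 by rewrite normr_eq0.
pose f : measurableTypeR R -> measurableTypeR R := fun x => a * x + b.
have mf : measurable_fun setT f := measurable_affine a b.
pose nu := mscale (NngNum (normr_ge0 a)) (pushforward (@lebesgue_measure R) f).
have -> : (@lebesgue_measure R) A = nu mf A.
  apply: lebesgue_measure_unique => // _ [[p q] _ <-] /=.
  rewrite /nu /mscale /= /pushforward /=.
  have [pq|qp] := ltP p q; last first.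
    by rewrite set_itv_ge ?bnd_simp -?leNgt// preimage_set0 !measure0 mule0.
  have [an|ap] := ltP a 0.
    rewrite preimage_affine_itv_neg// !lebesgue_measure_itv/= !lte_fin pq.
    rewrite ltr_ndivrMr// divfK// ltrD2r pq -EFinD ltr0_norm//.
    by rewrite -EFinM; congr EFin; field.
  have ap' : 0 < a by rewrite lt_neqAle eq_sym a0.
  rewrite preimage_affine_itv_pos// !lebesgue_measure_itv/= !lte_fin pq.
  rewrite ltr_pdivrMr// divfK// ltrD2r pq -EFinD gtr0_norm//.
  by rewrite -EFinM; congr EFin; field.
by rewrite /nu /mscale/= muleA -EFinM mulVf// mul1e.
Qed.

Lemma measurable_I01 (R : realType) : measurable (I01 R).
Proof. exact: measurable_itv. Qed.

Lemma lebesgue_measure_I01 (R : realType) : (@lebesgue_measure R) (I01 R) = 1%E.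
Proof. by rewrite lebesgue_measure_itv/= lte_fin ltr01 oppr0 adde0. Qed.

(** Serves both the tent map and the reflection [x |-> 1 - x]. Invariance is relative to [D] because
    the tent map, periodic on the line, preserves measure only within the unit interval. *)
Lemma integral_preserving (R : realType) (D : set R) (T : R -> R) (h : R -> R) :
  measurable D -> measurable_fun [set: R] T -> (forall x, D x -> D (T x)) ->
  (forall A, measurable A -> A `<=` D ->
    (@lebesgue_measure R) (D `&` T @^-1` A) = (@lebesgue_measure R) A) ->
  measurable_fun [set: R] h ->
  (@lebesgue_measure R).-integrable D (EFin \o (h \o T)) ->
  (\int[@lebesgue_measure R]_(x in D) (h (T x))%:E =
   \int[@lebesgue_measure R]_(x in D) (h x)%:E)%E.
Proof.
move=> mD mT DT pT mh ih.
(* The pushforward lemma integrates over the whole preimage of [D], so [T] is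
   replaced by the identity outside [D]. *)
pose S := patch idfun D T.
have SD x : D x -> S x = T x by move=> Dx; rewrite /S /patch mem_set.
have SDc x : ~ D x -> S x = x by move=> Dx; rewrite /S /patch memNset.
have mS : measurable_fun [set: R] S.
  apply: (measurable_fun_ifT (g := T) (h := idfun) (f := fun x => x \in D)) => //.
    apply: (measurable_fun_bool true).
    rewrite setTI (_ : _ @^-1` _ = D)//.
    by apply/seteqP; split=> x /=; [move/set_mem|move/mem_set ->].
  exact: measurable_id.
have SI A : A `<=` D -> S @^-1` A = D `&` T @^-1` A.
  move=> AD; apply/seteqP; split=> x /=.
    have [Dx|Dx] := pselect (D x); first by rewrite SD.
    by rewrite SDc// => /AD.
  by move=> [Dx Ax]; rewrite SD.
have SDD : S @^-1` D = D.
  by rewrite SI//; apply/seteqP; split=> x /=; [case|move=> Dx; split => //; exact: DT].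
transitivity (\int[@lebesgue_measure R]_(x in S @^-1` D) ((EFin \o h) \o S) x)%E.
  by rewrite SDD; apply: eq_integral => x /set_mem Dx /=; rewrite SD.
have mS1 : measurable_fun [set: measurableTypeR R] (S : R -> measurableTypeR R) := mS.
have mh' : measurable_fun [set: measurableTypeR R] (EFin \o h) by exact/measurable_EFinP.
have iS : (@lebesgue_measure R).-integrable (S @^-1` D) ((EFin \o h) \o S).
  by rewrite SDD; apply: eq_integrable ih => // x /set_mem Dx /=; rewrite SD.
rewrite -(integral_pushforward mS1 mh' iS)//.
apply: eq_measure_integral => A mA AD.
transitivity (lebesgue_measure (S @^-1` A)); first by [].
by rewrite SI// pT.
Qed.

(** * The tent map: range, symmetry, and invariance of Lebesgue measure *)

Lemma tent_bounds (R : realType) (x : R) : 0 <= tent x <= 1.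
Proof.
rewrite /tent; have /andP[] := floor_itv x; rewrite intrD /=.
set y := (Num.floor x)%:~R => h1 h2.
by case: ifPn; rewrite -?ltNge => ?; apply/andP; split; lra.
Qed.

Lemma tentE (R : realType) (x : R) : I01 R x ->
  tent x = if x <= 2^-1 then 2 * x else 2 * (1 - x).
Proof.
rewrite /I01 /= in_itv/= => /andP[x0 x1]; rewrite /tent.
(* At [x = 1] the fractional part is 0 instead of 1, but the value is 0 with either. *)
have [->|x1'] := eqVneq x 1.
  by rewrite floor1 subrr invr_ge0 ler0n mulr0 ifN ?subrr ?mulr0// -ltNge; lra.
by rewrite (@floor_def _ x 0) ?subr0 ?x0// add0r lt_neqAle x1'.
Qed.

Lemma tent_I01 (R : realType) (x : R) : I01 R (tent x).
Proof. by rewrite /I01 /= in_itv/= tent_bounds. Qed.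

Lemma measurable_tent (R : realType) : measurable_fun [set: R] (@tent R).
Proof.
have mf : measurable_fun [set: R] (fun x : R => x - (Num.floor x)%:~R).
  apply: measurable_funB; first exact: measurable_id.
  apply: nondecreasing_measurable => // x y xy.
  by rewrite ler_int; exact: le_floor.
apply: (@measurable_fun_ifT _ _ _ _ (fun x : R => 2 * (x - (Num.floor x)%:~R))
  (fun x : R => 2 * (1 - (x - (Num.floor x)%:~R)))
  (fun x : R => x - (Num.floor x)%:~R <= 2^-1)).
- exact: measurable_fun_ler.
- exact: measurable_funM.
- by apply: measurable_funM => //; exact: measurable_funB.
Qed.

Lemma measurable_tent_iter (R : realType) n :
  measurable_fun [set: R] (@tent_iter R n).
Proof.
elim: n => [|n IH]; first exact: measurable_id.
exact: (measurableT_comp (@measurable_tent R) IH).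
Qed.

Lemma tent_iterSr (R : realType) n (x : R) : tent_iter n.+1 x = tent_iter n (tent x).
Proof. exact: iterSr. Qed.

Lemma tent_iterD (R : realType) m n (x : R) :
  tent_iter (m + n) x = tent_iter m (tent_iter n x).
Proof. exact: iterD. Qed.

Lemma tent_iter_I01 (R : realType) n (x : R) : I01 R x -> I01 R (tent_iter n x).
Proof. by case: n => [//|n] _; exact: tent_I01. Qed.

Lemma reflect_I01 (R : realType) (x : R) : I01 R x -> I01 R (1 - x).
Proof. by rewrite /I01 /= !in_itv/= => /andP[? ?]; apply/andP; split; lra. Qed.

Lemma tent_reflect (R : realType) (x : R) : I01 R x -> tent (1 - x) = tent x.
Proof.
move=> Ix; rewrite !tentE//; last exact: reflect_I01.
by case: ifPn => h1; case: ifPn; rewrite -?ltNge => h2;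
  move: h1; rewrite -?ltNge => h1; lra.
Qed.

Lemma lebesgue_measure_reflect (R : realType) (A : set R) : measurable A ->
  A `<=` I01 R ->
  (@lebesgue_measure R) (I01 R `&` (fun x => 1 - x) @^-1` A) =
  (@lebesgue_measure R) A.
Proof.
move=> mA AI; rewrite -[RHS]mul1e -[in RHS]invr1 -[in RHS](@normrN1 R).
rewrite -(lebesgue_measure_affine 1)//; congr (lebesgue_measure _).
apply/seteqP; split=> x /=; rewrite mulN1r addrC.
  by case.
by move=> Ax; split => //; have := reflect_I01 (AI _ Ax); rewrite opprB addrC subrK.
Qed.

(** The preimage is the union of two affine preimages, of slopes [2] and [-2], each carrying half
    the measure of [A]. *)
Lemma lebesgue_measure_tent (R : realType) (A : set R) : measurable A ->
  A `<=` I01 R ->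
  (@lebesgue_measure R) (I01 R `&` (@tent R) @^-1` A) = (@lebesgue_measure R) A.
Proof.
move=> mA AI.
(* [1] is removed from one branch so that [1/2] is not counted twice. *)
pose l := fun x : R => 2 * x + 0; pose u := fun x : R => - 2 * x + 2.
have ml : measurable (l @^-1` A).
  by rewrite -[X in measurable X]setTI; exact: measurable_affine.
have mA1 : measurable (A `\ 1) by exact: measurableD.
have mu : measurable (u @^-1` (A `\ 1)).
  by rewrite -[X in measurable X]setTI; exact: measurable_affine.
have -> : I01 R `&` (@tent R) @^-1` A = (l @^-1` A) `|` (u @^-1` (A `\ 1)).
  apply/seteqP; split=> x /=.
    move=> [Ix]; rewrite tentE//; case: ifPn => h Ax.
      by left; rewrite /l addr0.
    right; have <- : 2 * (1 - x) = u x by rewrite /u; lra.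
    by split=> //; move: h; rewrite -ltNge => h e; lra.
  rewrite /l addr0 => -[Ax|[Ax e]]; have := AI _ Ax;
    rewrite {1}/I01 /= in_itv /= => /andP[h h0].
    have Ix : I01 R x by rewrite /I01 /= in_itv /=; apply/andP; split; lra.
    by split=> //; rewrite tentE// ifT//; lra.
  have Ix : I01 R x.
    rewrite /I01 /= in_itv /=; move: h h0; rewrite /u => h h0.
    by apply/andP; split; lra.
  split=> //; rewrite tentE//; case: ifPn => h2; last first.
    by have -> : 2 * (1 - x) = u x by rewrite /u; lra.
  (* Here [x <= 1/2] and [u x <= 1] force [u x = 1], the point that was removed. *)
  exfalso; apply: e; move: h h0; rewrite /u => h h0; lra.
transitivity ((@lebesgue_measure R) (l @^-1` A) +
              (@lebesgue_measure R) (u @^-1` (A `\ 1%R)))%E.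
  apply: measureU => //.
  apply/seteqP; split=> x //=; rewrite /l addr0 => -[Ax [Bx e]].
  have := AI _ Ax; rewrite {1}/I01 /= in_itv /= => /andP[h h0].
  have := AI _ Bx; rewrite {1}/I01 /= in_itv /= /u => /andP[h1 h1'].
  by apply: e; rewrite /u; lra.
have n2 : (- 2 : R) != 0 by rewrite oppr_eq0.
have A1 : (@lebesgue_measure R) (A `\ 1) = (@lebesgue_measure R) A.
  apply/eqP; rewrite eq_le; apply/andP; split.
    by apply: le_measure; rewrite ?inE//; exact: subDsetl.
  rewrite -[leRHS]adde0 -[in leRHS](lebesgue_measure_set1 (1 : R)).
  rewrite -measureU//; last by rewrite setDKI.
  apply: le_measure; rewrite ?inE//; first exact: measurableU.
  by rewrite setDKU; [] || (move=> x Ax; have [->|] := pselect (x = 1); [right|left]).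
have n2' : (2 : R) != 0 by [].
rewrite (lebesgue_measure_affine 0 n2' mA) (lebesgue_measure_affine 2 n2 mA1).
rewrite A1 normrN normr_nat -ge0_muleDl ?lee_fin//.
by rewrite -EFinD -[RHS]mul1e; congr (_ * _)%E; congr EFin; lra.
Qed.

(** * Bounded measurable functions on the unit interval and their means *)

(** A class closed under sums, products and composition with tent iterates, so that every
    integrability condition follows from membership. The bound is asked only on the unit interval,
    since the identity must belong. *)
Definition bmeas (R : realType) (h : R -> R) : Prop :=
  measurable_fun [set: R] h /\
  exists M : R, forall x, I01 R x -> `|h x| <= M.

Definition mean (R : realType) (h : R -> R) : R :=
  \int[@lebesgue_measure R]_(x in I01 R) h x.

Lemma bmeas_integrable (R : realType) (h : R -> R) : bmeas h ->
  (@lebesgue_measure R).-integrable (I01 R) (EFin \o h).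
Proof.
move=> [mh [M hM]]; apply: measurable_bounded_integrable.
- exact: measurable_I01.
- by rewrite [ltLHS](lebesgue_measure_I01 R) ltry.
- exact: measurable_funTS.
- exists M; split; first exact: num_real.
  by move=> y My x Ix; apply: le_trans (ltW My); exact: hM.
Qed.

Lemma mean_EFin (R : realType) (h : R -> R) : bmeas h ->
  (\int[@lebesgue_measure R]_(x in I01 R) (h x)%:E)%E = (mean h)%:E.
Proof.
move=> /bmeas_integrable ih; rewrite /mean fineK//.
by apply: integrable_fin_num ih; exact: measurable_I01.
Qed.

Lemma bmeas_cst (R : realType) (c : R) : bmeas (fun=> c).
Proof. by split => //; exists `|c|. Qed.

Lemma bmeasD (R : realType) (g h : R -> R) : bmeas g -> bmeas h ->
  bmeas (fun x => g x + h x).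
Proof.
move=> [mg [M gM]] [mh [N hN]]; split; first exact: measurable_funD.
exists (M + N) => x Ix; apply: le_trans (ler_normD _ _) _.
by apply: lerD; [exact: gM|exact: hN].
Qed.

Lemma bmeasM (R : realType) (g h : R -> R) : bmeas g -> bmeas h ->
  bmeas (fun x => g x * h x).
Proof.
move=> [mg [M gM]] [mh [N hN]]; split; first exact: measurable_funM.
exists (M * N) => x Ix; rewrite normrM.
by apply: ler_pM => //; [exact: gM|exact: hN].
Qed.

Lemma bmeasZ (R : realType) (c : R) (h : R -> R) : bmeas h ->
  bmeas (fun x => c * h x).
Proof. exact: (bmeasM (bmeas_cst c)). Qed.

Lemma bmeas_sum (R : realType) (h : nat -> R -> R) (s : seq nat) :
  (forall n, bmeas (h n)) -> bmeas (fun x => \sum_(n <- s) h n x).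
Proof.
move=> mh; elim: s => [|n s IH].
  rewrite (_ : (fun _ => _) = fun=> 0); first exact: bmeas_cst.
  by apply/funext => x; rewrite big_nil.
rewrite (_ : (fun _ => _) = fun x => h n x + \sum_(n <- s) h n x); first exact: bmeasD.
by apply/funext => x; rewrite big_cons.
Qed.

Lemma bmeas_id (R : realType) : bmeas (@idfun R).
Proof.
split; first exact: measurable_id.
by exists 1 => x; rewrite /I01 /= in_itv/= => /andP[x0 x1]; rewrite ger0_norm.
Qed.

Lemma bmeas_comp (R : realType) (h T : R -> R) : bmeas h ->
  measurable_fun [set: R] T -> (forall x, I01 R x -> I01 R (T x)) ->
  bmeas (fun x => h (T x)).
Proof.
move=> [mh [M hM]] mT TI; split; first exact: (measurableT_comp mh mT).
by exists M => x /TI; exact: hM.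
Qed.

Lemma bmeas_tent_iter (R : realType) (h : R -> R) n : bmeas h ->
  bmeas (fun x => h (tent_iter n x)).
Proof.
move=> bh; apply: bmeas_comp bh _ _; first exact: measurable_tent_iter.
exact: tent_iter_I01.
Qed.

Lemma meanD (R : realType) (g h : R -> R) : bmeas g -> bmeas h ->
  mean (fun x => g x + h x) = mean g + mean h.
Proof.
move=> /bmeas_integrable ig /bmeas_integrable ih.
by rewrite /mean RintegralD//; exact: measurable_I01.
Qed.

Lemma meanZ (R : realType) (c : R) (h : R -> R) : bmeas h ->
  mean (fun x => c * h x) = c * mean h.
Proof.
by move=> /bmeas_integrable ih; rewrite /mean RintegralZl//; exact: measurable_I01.
Qed.

Lemma mean_cst (R : realType) (c : R) : mean (fun=> c) = c.
Proof.
rewrite /mean Rintegral_cst; last exact: measurable_I01.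
by rewrite [X in fine X](lebesgue_measure_I01 R) mulr1.
Qed.

Lemma eq_mean (R : realType) (g h : R -> R) :
  (forall x, I01 R x -> g x = h x) -> mean g = mean h.
Proof. by move=> gh; apply: eq_Rintegral => x /set_mem; exact: gh. Qed.

Lemma le_mean (R : realType) (g h : R -> R) : bmeas g -> bmeas h ->
  (forall x, I01 R x -> g x <= h x) -> mean g <= mean h.
Proof.
move=> /bmeas_integrable ig /bmeas_integrable ih gh.
by apply: le_Rintegral => //; exact: measurable_I01.
Qed.

Lemma mean_sum (R : realType) (h : nat -> R -> R) (s : seq nat) :
  (forall n, bmeas (h n)) ->
  mean (fun x => \sum_(n <- s) h n x) = \sum_(n <- s) mean (h n).
Proof.
move=> mh; elim: s => [|n s IH].
  by rewrite big_nil -[RHS](@mean_cst R); apply: eq_mean => x _; rewrite big_nil.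
rewrite big_cons -IH -meanD//; last exact: bmeas_sum.
by apply: eq_mean => x _; rewrite big_cons.
Qed.

Lemma mean_tent (R : realType) (h : R -> R) : bmeas h ->
  mean (fun x => h (tent x)) = mean h.
Proof.
move=> bh; rewrite /mean /Rintegral; congr fine.
apply: (@integral_preserving _ (I01 R) (@tent R)).
- exact: measurable_I01.
- exact: measurable_tent.
- by move=> x _; exact: tent_I01.
- exact: lebesgue_measure_tent.
- by case: bh.
- exact: (bmeas_integrable (bmeas_tent_iter 1 bh)).
Qed.

Lemma mean_tent_iter (R : realType) (h : R -> R) n : bmeas h ->
  mean (fun x => h (tent_iter n x)) = mean h.
Proof.
move=> bh; elim: n => [//|n IH]; rewrite -[RHS]IH -(mean_tent (bmeas_tent_iter n bh)).
by apply: eq_mean => x _; rewrite tent_iterSr.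
Qed.

(** Reflection about [1/2] preserves Lebesgue measure, so the mean equals its own negative. *)
Lemma mean_odd (R : realType) (h : R -> R) : bmeas h ->
  (forall x, I01 R x -> h (1 - x) = - h x) -> mean h = 0.
Proof.
move=> bh oh.
have mr : measurable_fun [set: R] (fun x : R => 1 - x) by exact: measurable_funB.
have : mean (fun x => h (1 - x)) = mean h.
  rewrite /mean /Rintegral; congr fine.
  apply: (@integral_preserving _ (I01 R) (fun x => 1 - x)) => //.
  - exact: measurable_I01.
  - exact: reflect_I01.
  - exact: lebesgue_measure_reflect.
  - by case: bh.
  - by apply: bmeas_integrable; apply: bmeas_comp bh mr _; exact: reflect_I01.
rewrite (eq_mean (h := fun x => -1 * h x)); last by move=> x Ix; rewrite oh// mulN1r.
by rewrite meanZ// => e; lra.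
Qed.

(** * Orthogonality of the centered iterates *)

Definition centered (R : realType) n (x : R) : R := tent_iter n x - 2^-1.

Lemma bmeas_centered (R : realType) n : bmeas (@centered R n).
Proof. by apply: bmeasD; [exact: bmeas_tent_iter (bmeas_id R)|exact: bmeas_cst]. Qed.

Lemma centered_le (R : realType) n (x : R) : I01 R x -> `|centered n x| <= 2^-1.
Proof.
move=> /(tent_iter_I01 n); rewrite /I01 /= in_itv/= => /andP[h0 h1].
by rewrite ler_norml /centered; apply/andP; split; lra.
Qed.

Lemma mean_centered (R : realType) n : mean (@centered R n) = 0.
Proof.
rewrite (mean_tent_iter n (bmeas_centered R 0)); apply: mean_odd.
  exact: bmeas_centered.
by move=> x _; rewrite /centered /=; lra.
Qed.

(** Invariance under [tent_iter m] reduces to the indices [0] and [n - m]. As [n - m > 0], the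
    second factor is symmetric under reflection while [x - 1/2] is antisymmetric, so the product is
    odd. *)
Lemma mean_centeredM (R : realType) m n : (m < n)%N ->
  mean (fun x : R => centered m x * centered n x) = 0.
Proof.
move=> mn.
have bc : bmeas (fun x : R => centered 0 x * centered (n - m) x).
  by apply: bmeasM; exact: bmeas_centered.
rewrite -(mean_odd bc).
  rewrite -[RHS](mean_tent_iter m bc); apply: eq_mean => x _.
  by rewrite /centered -(tent_iterD (n - m)) subnK// ltnW.
move=> x Ix; have -> : (n - m)%N = (n - m).-1.+1 by rewrite prednK// subn_gt0.
by rewrite /centered !tent_iterSr tent_reflect//= -mulNr; congr (_ * _); lra.
Qed.

(** Each new index adds a cross term, of mean 0 by orthogonality, and a square, which is at most
    [1/4] and is bounded here by 1. *)
Lemma mean_sum_centered_sqr (R : realType) N :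
  mean (fun x : R => (\sum_(1 <= n < N.+1) centered n x) ^+ 2) <= N%:R.
Proof.
elim: N => [|N IH].
  rewrite (@eq_mean _ _ (fun=> 0)) ?mean_cst// => x _.
  by rewrite big_geq// expr2 mulr0.
have bS : bmeas (fun x : R => \sum_(1 <= n < N.+1) centered n x).
  by apply: bmeas_sum => n; exact: bmeas_centered.
have bc := bmeas_centered R N.+1.
have bSc := bmeasM bS bc.
pose S := fun x : R => \sum_(1 <= n < N.+1) centered n x.
rewrite (@eq_mean _ _ (fun x => S x ^+ 2 + (2 * (S x * centered N.+1 x)
    + centered N.+1 x * centered N.+1 x))); last first.
  by move=> x _; rewrite big_nat_recr//= -/(S x); ring.
rewrite meanD; [|exact: (bmeasM bS bS)|]; last first.
  by apply: bmeasD; [exact: bmeasZ|exact: bmeasM].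
rewrite meanD; [|exact: bmeasZ|exact: bmeasM].
rewrite meanZ// -(natr1 N); apply: lerD => //.
have -> : mean (fun x => S x * centered N.+1 x) = 0.
  rewrite (@eq_mean _ _
    (fun x => \sum_(n <- index_iota 1 N.+1) centered n x * centered N.+1 x)).
    rewrite mean_sum; last by move=> n; apply: bmeasM => //; exact: bmeas_centered.
    rewrite big_nat_cond big1// => n; rewrite andbT => /andP[_ nN].
    exact: mean_centeredM.
  by move=> x _; rewrite mulr_suml.
rewrite mulr0 add0r -[leRHS](@mean_cst R); apply: le_mean.
- exact: bmeasM.
- exact: bmeas_cst.
- move=> x /(@centered_le R N.+1 x); rewrite ler_norml => /andP[? ?].
  by nra.
Qed.

(** * Averages along the squares and almost everywhere convergence *)

Lemma exists_square_floor n : (0 < n)%N ->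
  exists m, (m.+1 ^ 2 <= n < m.+2 ^ 2)%N.
Proof.
elim: n => [//|[|n] IH _]; first by exists 0.
have [m /andP[m1 m2]] := IH isT.
have [h|h] := ltnP n.+2 (m.+2 ^ 2).
  by exists m; rewrite h (leq_trans m1).
exists m.+1; rewrite h /=; apply: (leq_ltn_trans m2).
by rewrite ltn_sqr.
Qed.

Lemma dist_le_index (R : realType) (s : nat -> R) m k :
  (forall n, `|s n.+1 - s n| <= 1) -> `|s (m + k)%N| <= `|s m| + k%:R.
Proof.
move=> hs; elim: k => [|k IH]; first by rewrite addn0 addr0.
rewrite addnS -[s _.+1](subrK (s (m + k)%N)) addrC -natr1 [leRHS]addrA.
exact: le_trans (ler_normD _ _) (lerD IH (hs _)).
Qed.

(** For [n] between [(m + 1)^2] and [(m + 2)^2], the value [s n] differs from that at the lower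
    square by at most [2 (m + 1)], which is negligible against [n]. *)
Lemma cvg_avg_squares (R : realType) (s : nat -> R) :
  (forall n, `|s n.+1 - s n| <= 1) ->
  s (m.+1 ^ 2)%N / (m.+1 ^ 2)%:R @[m --> \oo] --> (0 : R) ->
  s n / n%:R @[n --> \oo] --> (0 : R).
Proof.
move=> hs /cvgrPdist_le hc; apply/cvgrPdist_le => e e0.
have e2 : 0 < e / 2 by rewrite divr_gt0.
have [M _ hM] := hc _ e2.
(* Once [m + 1 >= 4 / e], the gap [2 (m + 1)] is at most [(e / 2) (m + 1)^2]; the other half of [e]
   comes from the average along the squares. *)
pose K := Num.truncn (4 / e).
near=> n.
have n0 : (0 < n)%N by near: n; exact: nbhs_infty_gt.
have [m /andP[m1 m2]] := exists_square_floor n0.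
have nM : (M.+1 ^ 2 <= n)%N by near: n; exact: nbhs_infty_ge.
have nK : (K.+1 ^ 2 <= n)%N by near: n; exact: nbhs_infty_ge.
have Mm : (M <= m)%N.
  by have := leq_ltn_trans nM m2; rewrite ltn_sqr ltnS.
have Km : (K <= m)%N.
  by have := leq_ltn_trans nK m2; rewrite ltn_sqr ltnS.
have := hM _ Mm; rewrite /= !sub0r !normrN !normrM !normfV !normr_nat.
have m0 : (0 : R) < (m.+1 ^ 2)%:R by rewrite ltr0n expn_gt0.
rewrite ler_pdivrMr// => h1; rewrite ler_pdivrMr ?ltr0n//.
have := dist_le_index (m.+1 ^ 2) (n - m.+1 ^ 2) hs.
rewrite subnKC// => h2.
have h3 : (n - m.+1 ^ 2)%:R <= 2 * m.+1%:R :> R.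
  by rewrite -natrM ler_nat leq_subLR; move: m2; lia.
have h4 : 4 / e <= m.+1%:R.
  apply/ltW; apply: lt_le_trans (truncnS_gt _) _.
  by rewrite ler_nat ltnS.
have h5 : 4 <= m.+1%:R * e by rewrite -ler_pdivrMr.
have h6 : (m.+1 ^ 2)%:R <= n%:R :> R by rewrite ler_nat.
have h7 : 0 < m.+1%:R :> R by rewrite ltr0n.
have h8 : (m.+1 ^ 2)%:R = m.+1%:R * m.+1%:R :> R by rewrite natrX expr2.
apply: (le_trans h2); apply: (@le_trans _ _ (e * (m.+1 ^ 2)%:R)); last first.
  by rewrite ler_wpM2l// ltW.
by rewrite h8 in h1 *; nra.
Unshelve. all: by end_near. Qed.

(** The correction [2 / (n + 1)] lets the induction close; what summability needs is the uniform
    bound 2. *)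
Lemma sum_inv_sqr_le (R : realType) n :
  \sum_(0 <= m < n) ((m.+1 ^ 2)%:R^-1 : R) <= 2 - 2 / n.+1%:R.
Proof.
elim: n => [|n IH]; first by rewrite big_geq// divr1 subrr.
rewrite big_nat_recr//=; apply: le_trans (lerD IH (lexx _)) _.
have h0 : 0 < n.+1%:R :> R by rewrite ltr0n.
rewrite -(natr1 n.+1) natrX; set t : R := n.+1%:R in h0 *.
have t1 : 1 <= t by rewrite /t ler1n.
rewrite -subr_ge0 (_ : _ - _ = (t - 1) / (t ^+ 2 * (t + 1))); last first.
  by field; rewrite !gt_eqF// ltr_wpDl// ltW.
by rewrite divr_ge0 ?subr_ge0// mulr_ge0 ?sqr_ge0// addr_ge0// ltW.
Qed.

(** The squared averages at the indices [(m + 1)^2] have means at most [1 / (m + 1)^2]. Their sum is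
    therefore integrable, hence finite almost everywhere, and there its terms tend to 0. *)
Lemma ae_avg_centered (R : realType) :
  {ae @lebesgue_measure R, forall x, I01 R x ->
    (\sum_(1 <= n < N.+1) centered n x) / N%:R @[N --> \oo] --> (0 : R)}.
Proof.
pose S N (x : R) := \sum_(1 <= n < N.+1) centered n x.
pose f m (x : R) := (S (m.+1 ^ 2)%N x / (m.+1 ^ 2)%:R) ^+ 2.
have bS N : bmeas (S N) by apply: bmeas_sum => n; exact: bmeas_centered.
have bf m : bmeas (f m).
  have b1 := bmeasM (bS (m.+1 ^ 2)%N) (bmeas_cst (m.+1 ^ 2)%:R^-1).
  exact: (bmeasM b1 b1).
have f0 m x : 0 <= f m x by exact: sqr_ge0.
have mEf m : measurable_fun (I01 R) (EFin \o f m).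
  by apply/measurable_EFinP; apply: measurable_funTS; case: (bf m).
have mf m : mean (f m) <= (m.+1 ^ 2)%:R^-1.
  have b2 : bmeas (fun x => S (m.+1 ^ 2)%N x ^+ 2) by exact: (bmeasM (bS _) (bS _)).
  have m0 : (0 : R) < (m.+1 ^ 2)%:R by rewrite ltr0n expn_gt0.
  rewrite (@eq_mean _ _ (fun x => (m.+1 ^ 2)%:R ^- 2 * S (m.+1 ^ 2)%N x ^+ 2)).
    rewrite meanZ// mulrC ler_pdivrMr ?exprn_gt0// expr2 mulKf ?gt_eqF//.
    exact: mean_sum_centered_sqr.
  by move=> x _; rewrite /f expr_div_n mulrC.
have intf : (\int[@lebesgue_measure R]_(x in I01 R)
    (\sum_(m <oo) (f m x)%:E) <= 2%:E)%E.
  rewrite integral_nneseries//; last 2 first.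
    exact: measurable_I01.
    by move=> m x _; rewrite lee_fin.
  apply: lime_le.
    by apply: is_cvg_nneseries => m _ _; apply: integral_ge0 => x _; rewrite lee_fin.
  apply: nearW => n; under eq_bigr do rewrite mean_EFin//.
  rewrite sumEFin lee_fin.
  apply: (le_trans (ler_sum _ (fun m _ => mf m))).
  apply: (le_trans (sum_inv_sqr_le _ _)).
  by rewrite lerBlDr lerDl divr_ge0.
have isum : (@lebesgue_measure R).-integrable (I01 R)
    (fun x => \sum_(m <oo) (f m x)%:E)%E.
  apply/integrableP; split.
    apply: (@ge0_emeasurable_sum _ _ _ _ (fun m x => (f m x)%:E) xpredT).
      by move=> m x _ _; rewrite lee_fin.
    by move=> m _; exact: mEf.
  apply: (@le_lt_trans _ _ 2%:E); last exact: ltry.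
  apply: le_trans intf; rewrite le_eqVlt; apply/orP; left; apply/eqP.
  apply: eq_integral => x _.
  by rewrite gee0_abs// nneseries_ge0// => m _ _; rewrite lee_fin.
have mI : measurable (I01 R : set (measurableTypeR R)) := @measurable_I01 R.
have := integrable_ae mI isum.
apply: filterS => x fx Ix; move: (fx Ix); rewrite ge0_fin_numE; last first.
  by apply: nneseries_ge0 => m _ _; rewrite lee_fin.
move=> /(nnseries_is_cvg (f0 ^~ x)) /cvg_series_cvg_0 /cvgrPdist_le fx0.
apply: cvg_avg_squares.
  (* Consecutive partial sums differ by one centered iterate, of size at most [1/2]. *)
  move=> n; rewrite [X in `|X - _|]big_nat_recr//= addrAC subrr add0r.
  apply: (le_trans (centered_le _ Ix)); lra.
apply/cvgrPdist_le => e e0.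
have e2 : 0 < e ^+ 2 by rewrite exprn_gt0.
apply: filterS (fx0 _ e2) => m /=; rewrite !sub0r !normrN (ger0_norm (f0 _ _)).
by rewrite /f -[X in X <= _]real_normK ?num_real// ler_pXn2r// nnegrE ltW.
Qed.

(** * The limit variable and its functional equation *)

(** Summation starts at [k = 0]: factoring [r ^+ N] out of the tail of [f_full] turns its first term
    into [tent_iter 0] at the point [tent_iter N x]. *)
Definition tail_series (R : realType) (r x : R) : R ^nat :=
  series (fun k => r ^+ k * tent_iter k x).

(** The factor [2 (1 - r)] is the reciprocal of half the geometric series in [r]. *)
Definition tail_limit (R : realType) (r x : R) : R :=
  2 * (1 - r) * limn (tail_series r x).

Lemma subr1_neq0 (R : realType) (r : R) : `|r| < 1 -> 1 - r != 0.
Proof.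
move=> r1; rewrite subr_eq0 eq_sym lt_eqF//.
by apply: le_lt_trans r1; exact: ler_norm.
Qed.

Section tail.
Context {R : realType} (r : R).
Hypothesis r1 : `|r| < 1.

Lemma is_cvg_normed_tail_series (x : R) :
  cvgn [normed series (fun k => r ^+ k * tent_iter k x)].
Proof.
(* As [x] is any real, the term [k = 0] has size [|x|], while later iterates lie in the unit
   interval; [|x| + 1] dominates both. Convergence on the whole line gives measurability there. *)
apply: (@series_le_cvg _ _ (geometric (`|x| + 1) `|r|)).
- by move=> n /=.
- by move=> n /=; rewrite mulr_ge0// ?addr_ge0// exprn_ge0.
- move=> n /=; rewrite normrM normrX mulrC ler_wpM2r ?exprn_ge0//.
  case: n => [|n] /=; first by rewrite lerDl.
  have /andP[t0 t1] := tent_bounds (iter n tent x).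
  by rewrite ger0_norm// (le_trans t1)// lerDr.
- by apply: is_cvg_geometric_series; rewrite normr_id.
Qed.

Lemma is_cvg_tail_series (x : R) : cvgn (tail_series r x).
Proof. exact/normed_cvg/is_cvg_normed_tail_series. Qed.

Lemma measurable_tail_limit : measurable_fun [set: R] (tail_limit r).
Proof.
apply: measurable_funM => //.
apply: (@measurable_fun_cvg _ _ _ _ (fun n x => tail_series r x n)).
  move=> n; apply: measurable_sum => k; apply: measurable_funM => //.
  exact: measurable_tent_iter.
by move=> x _; exact: is_cvg_tail_series.
Qed.

Lemma bmeas_tail_limit : bmeas (tail_limit r).
Proof.
split; first exact: measurable_tail_limit.
exists (`|2 * (1 - r)| * (1 - `|r|)^-1) => x Ix.
rewrite /tail_limit normrM ler_wpM2l//.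
have /le_trans := lim_series_norm (@is_cvg_normed_tail_series x); apply.
have cg := @cvg_geometric_series R 1 `|r|; rewrite normr_id mul1r in cg.
rewrite -(cvg_lim _ (cg r1))//; apply: lim_series_le.
- exact: is_cvg_normed_tail_series.
- exact: cvgP (cg r1).
- move=> n /=; rewrite normrM normrX mul1r ler_piMr// ?exprn_ge0//.
  have := tent_iter_I01 n Ix; rewrite /I01 /= in_itv/= => /andP[t0 t1].
  by rewrite ger0_norm.
Qed.

(** Splitting off the term [k = 0] leaves [r] times the series at [tent x]. *)
Lemma tail_limit_tent (x : R) :
  tail_limit r x = 2 * (1 - r) * x + r * tail_limit r (tent x).
Proof.
rewrite /tail_limit; suff -> : limn (tail_series r x) = x + r * limn (tail_series r (tent x)).
  by ring.
apply/cvg_lim => //; rewrite -cvg_shiftS /=.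
rewrite (_ : (fun n : nat => _) = fun n => x + r * tail_series r (tent x) n).
  by apply: cvgD; [exact: cvg_cst|apply: cvgMl_tmp; exact: is_cvg_tail_series].
apply/funext => n; rewrite /tail_series /series /= big_nat_recl// expr0 mul1r; congr (_ + _).
by rewrite mulr_sumr; apply: eq_bigr => k _; rewrite exprS mulrA tent_iterSr.
Qed.

(** The factor [r ^+ N] cancels between the tail of [f_full] and the geometric tail. At [N = 0] the
    denominator would contain [r ^+ 0], whereas [f_full] starts at index 1. *)
Lemma normalized_tailE N (x : R) : 0 < `|r| -> (0 < N)%N ->
  normalized_tail r N x = tail_limit r (tent_iter N x).
Proof.
move=> r0 N0; have rn0 : r != 0 by rewrite -normr_gt0.
have r1' := subr1_neq0 r1.
have sumE : \big[+%R/0%R]_(N <= n <oo) (r ^+ n) = r ^+ N / (1 - r).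
  apply/cvg_lim => //; rewrite -(cvg_shiftn N) /=.
  rewrite (_ : (fun n : nat => _) = series (geometric (r ^+ N) r)).
    exact: cvg_geometric_series.
  by apply/funext => n; rewrite /= addnC geometric_partial_tail.
have fullE : f_full r x =
    f_partial r N x + r ^+ N * limn (tail_series r (tent_iter N x)).
  apply/cvg_lim => //; rewrite -(cvg_shiftn N) /=.
  rewrite (_ : (fun n : nat => _) = fun n => f_partial r N x +
      r ^+ N * tail_series r (tent_iter N x) n).
    by apply: cvgD; [exact: cvg_cst|apply: cvgMl_tmp; exact: is_cvg_tail_series].
  apply/funext => n; rewrite /= (@big_cat_nat _ _ _ N)// ?leq_addl//; congr (_ + _).
  rewrite -{1}[N]add0n big_addn addnK mulr_sumr; apply: eq_bigr => k _.
  by rewrite exprD tent_iterD mulrCA mulrA mulrAC.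
rewrite /normalized_tail sumE fullE addrAC subrr add0r /tail_limit.
by field; rewrite r1' expf_neq0.
Qed.

End tail.

(** * Orbit sums, mean and nondegeneracy of the limit variable *)

Lemma lebesgue_measure_tent_iter (R : realType) n (A : set R) : measurable A ->
  A `<=` I01 R ->
  (@lebesgue_measure R) (I01 R `&` (@tent_iter R n) @^-1` A) =
  (@lebesgue_measure R) A.
Proof.
move=> mA AI; elim: n => [|n IH].
  by congr (lebesgue_measure _); apply/seteqP; split=> x /= => [[]//|Ax]; split=> //; exact: AI.
rewrite -[RHS]IH -[RHS]lebesgue_measure_tent.
- congr (lebesgue_measure _); apply/seteqP; split=> x /=;
    rewrite -[tent (iter n tent x)]/(tent_iter n.+1 x) tent_iterSr.
    by move=> [Ix Ax]; split=> //; split=> //; exact: tent_I01.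
  by move=> [Ix [_ Ax]].
- apply: measurableI; first exact: measurable_I01.
  by rewrite -[X in measurable X]setTI; exact: measurable_tent_iter.
- exact: subIsetl.
Qed.

(** Sum [L y - r L (tent y) = 2 (1 - r) y] over the orbit points [y], with [L] the function
    [tail_limit r], and write [2 y] as 1 plus twice the centered value. Only the two boundary terms
    survive. *)
Lemma sum_tail_limit (R : realType) (r x : R) n : `|r| < 1 ->
  (1 - r) * (\sum_(1 <= N < n.+1) tail_limit r (tent_iter N x)) =
  (1 - r) * (n%:R + 2 * \sum_(1 <= N < n.+1) centered N x) +
  r * (tail_limit r (tent_iter n.+1 x) - tail_limit r (tent x)).
Proof.
move=> r1; elim: n => [|n IH].
  by rewrite !big_geq// subrr !(mulr0, addr0).
rewrite [in LHS]big_nat_recr//= mulrDr IH [in RHS]big_nat_recr//=.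
rewrite -(natr1 n) [in LHS](tail_limit_tent r1 (tent_iter n.+1 x)) /centered.
set a := \sum_(_ <= _ < _) _.
rewrite /tent_iter/=; lra.
Qed.

Lemma cesaro_tailE (R : realType) (r x : R) n : 0 < `|r| -> `|r| < 1 ->
  cesaro_tail r n x = n%:R^-1 * \sum_(1 <= N < n.+1) tail_limit r (tent_iter N x).
Proof.
move=> r0 r1; congr (_ * _); rewrite !big_nat; apply: eq_bigr => N /andP[N0 _].
exact: normalized_tailE.
Qed.

(** By invariance the functional equation integrates to [m = (1 - r) + r m], and [1 - r] is
    nonzero. *)
Lemma mean_tail_limit (R : realType) (r : R) : `|r| < 1 -> mean (tail_limit r) = 1.
Proof.
move=> r1; have bL := bmeas_tail_limit r1.
have r1' := subr1_neq0 r1.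
have bi := bmeas_id R.
have m2 : mean (@idfun R) = 2^-1.
  have := mean_centered R 0; rewrite /centered /= meanD//; last exact: bmeas_cst.
  by rewrite mean_cst => /eqP; rewrite subr_eq0 => /eqP.
have bT := bmeas_tent_iter 1 bL.
have : mean (tail_limit r) = (1 - r) + r * mean (tail_limit r).
  rewrite {1}(eq_mean (fun x _ => tail_limit_tent r1 x)).
  rewrite (meanD (bmeasZ (2 * (1 - r)) bi) (bmeasZ r bT)).
  by rewrite (meanZ (2 * (1 - r)) bi) (meanZ r bT) m2 (mean_tent bL); field.
move=> e; apply: (mulfI r1'); lra.
Qed.

(** If neither [x] nor [tent x] is exceptional, the functional equation reads
    [c = 2 (1 - r) x + r c], so [x = c / 2]. The unit interval would then be covered by two null
    sets and a point. *)
Lemma tail_limit_not_ae_cst (R : realType) (r : R) : `|r| < 1 ->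
  ~ (exists c : R, {ae @lebesgue_measure R, forall x, I01 R x -> tail_limit r x = c}).
Proof.
move=> r1 [c [N [mN N0 hN]]].
have r1' := subr1_neq0 r1.
pose B := N `&` I01 R.
have mI := @measurable_I01 R.
have mB : measurable B by exact: measurableI.
have B0 : (@lebesgue_measure R) B = 0%E.
  by apply: (subset_measure0 mB mN) => //; exact: subIsetl.
have mT : measurable (I01 R `&` (@tent R) @^-1` B).
  apply: measurableI => //.
  by rewrite -[X in measurable X]setTI; exact: measurable_tent.
have T0 : (@lebesgue_measure R) (I01 R `&` (@tent R) @^-1` B) = 0%E.
  by rewrite lebesgue_measure_tent//; exact: subIsetr.
have sub : I01 R `<=` (B `|` (I01 R `&` (@tent R) @^-1` B)) `|` [set c / 2].
  move=> x Ix; have [Bx|Bx] := pselect (B x); first by left; left.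
  have [Tx|Tx] := pselect (B (tent x)); first by left; right.
  right => /=.
  have Lc y : I01 R y -> ~ B y -> tail_limit r y = c.
    move=> Iy By; apply: contrapT => Ly; apply: By; split=> //.
    by apply: hN => /= /(_ Iy).
  have := tail_limit_tent r1 x; rewrite !Lc//; last exact: tent_I01.
  move=> e; apply: (mulfI r1'); lra.
have mU : measurable (B `|` (I01 R `&` (@tent R) @^-1` B)) by exact: measurableU.
have m1 : measurable [set c / 2] by exact: measurable_set1.
have U0 : (@lebesgue_measure R) (B `|` (I01 R `&` (@tent R) @^-1` B)) = 0%E.
  exact: null_set_setU.
have : ((@lebesgue_measure R) (I01 R) <= 0)%E.
  rewrite -(null_set_setU mU m1 U0 (lebesgue_measure_set1 _)).
  by apply: le_measure; rewrite ?inE//; exact: measurableU.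
by rewrite lebesgue_measure_I01 lee_fin ler10.
Qed.

(** * Convergence in distribution and of the Cesaro averages *)

(** By invariance every normalized tail with [N > 0] has the law of [tail_limit r], so the
    distribution functions are eventually constant in [N]. *)
Lemma cvg_distribution_tail (R : realType) (r : R) : 0 < `|r| -> `|r| < 1 ->
  cvg_in_distribution01 (normalized_tail r) (tail_limit r).
Proof.
move=> r0 r1 t _.
have mA : measurable (I01 R `&` [set x | tail_limit r x <= t]).
  apply: measurableI; first exact: measurable_I01.
  have := measurable_tail_limit r1 measurableT (measurable_itv `]-oo, t]).
  by rewrite setTI; congr measurable; apply/seteqP; split=> x /=; rewrite in_itv.
apply: (@cvg_near_cst _ _ _ _ _ _).
near=> N.
have N0 : (0 < N)%N by near: N; exact: nbhs_infty_gt.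
rewrite /cdf01 -(lebesgue_measure_tent_iter N mA); last exact: subIsetl.
congr (fine (lebesgue_measure _)); apply/seteqP; split=> x /=; rewrite normalized_tailE//.
  by move=> [Ix Lx]; split=> //; split=> //; exact: tent_iter_I01.
by move=> [Ix [_ Lx]].
Unshelve. all: by end_near. Qed.

(** Dividing the telescoped sum by [(1 - r) N] gives 1, plus twice the centered average, plus a
    bounded boundary term over [N]. *)
Lemma cvg_cesaro_tail (R : realType) (r x : R) : 0 < `|r| -> `|r| < 1 ->
  I01 R x ->
  (\sum_(1 <= n < N.+1) centered n x) / N%:R @[N --> \oo] --> (0 : R) ->
  cesaro_tail r N x @[N --> \oo] --> (1 : R).
Proof.
move=> r0 r1 Ix hS.
have r1' := subr1_neq0 r1.
have [_ [K hK]] := bmeas_tail_limit r1.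
pose b N := (tail_limit r (tent_iter N.+1 x) - tail_limit r (tent x)) / N%:R.
have hb : b N @[N --> \oo] --> (0 : R).
  rewrite -cvg_shiftS; apply/cvgr0Pnorm_le => e e0.
  near=> N; rewrite /b normrM normfV normr_nat ler_pdivrMr//.
  apply: (@le_trans _ _ (K + K)).
    apply: le_trans (ler_normB _ _) _.
    by apply: lerD; apply: hK; [exact: tent_iter_I01|exact: tent_I01].
  rewrite mulrC -ler_pdivrMr//; apply/ltW; apply: lt_le_trans (truncnS_gt _) _.
  rewrite ler_nat ltnS; near: N; exact: nbhs_infty_ge.
have h1 : 2 * ((\sum_(1 <= n < N.+1) centered n x) / N%:R) @[N --> \oo]
    --> 2 * (0 : R).
  by apply: cvgMl_tmp; exact: hS.
have h2 : r / (1 - r) * b N @[N --> \oo] --> r / (1 - r) * (0 : R).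
  by apply: cvgMl_tmp; exact: hb.
have hlim : (fun N => 1 + 2 * ((\sum_(1 <= n < N.+1) centered n x) / N%:R) +
    r / (1 - r) * b N) @ \oo --> (1 : R).
  have := cvgD (cvgD (cvg_cst (1 : R)) h1) h2.
  by rewrite !mulr0 !addr0; apply.
(* At [N = 0] the average is 0 while the formula gives 1, so the two sequences agree only
   eventually. *)
apply: cvg_trans hlim; apply: near_eq_cvg; near=> N.
have N0 : N%:R != 0 :> R.
  by rewrite pnatr_eq0 -lt0n; near: N; exact: nbhs_infty_gt.
rewrite /= cesaro_tailE//; apply: (mulfI r1').
rewrite [RHS]mulrCA sum_tail_limit// /b.
by field; rewrite r1' N0.
Unshelve. all: by end_near. Qed.

Lemma bmeas_cesaro_tail (R : realType) (r : R) n : 0 < `|r| -> `|r| < 1 ->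
  bmeas (cesaro_tail r n).
Proof.
move=> r0 r1; rewrite (_ : cesaro_tail r n = fun x =>
    n%:R^-1 * \sum_(1 <= N < n.+1) tail_limit r (tent_iter N x)); last first.
  by apply/funext => x; exact: cesaro_tailE.
apply: bmeasZ; apply: bmeas_sum => N; apply: bmeas_tent_iter; exact: bmeas_tail_limit.
Qed.

Lemma cesaro_tail_bounded (R : realType) (r : R) : 0 < `|r| -> `|r| < 1 ->
  exists K : R, forall n x, I01 R x -> `|cesaro_tail r n x| <= K.
Proof.
move=> r0 r1; have [_ [K hK]] := bmeas_tail_limit r1.
(* Nonnegativity covers [n = 0], where the average is 0; it is read off at a point of the unit
   interval. *)
have K0 : 0 <= K by apply: le_trans (hK _ (tent_I01 0)).
exists K => n x Ix; rewrite cesaro_tailE// normrM normfV normr_nat.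
have [->|n0] := posnP n; first by rewrite invr0 mul0r.
rewrite ler_pdivrMl ?ltr0n//; apply: le_trans (ler_norm_sum _ _ _) _.
apply: (@le_trans _ _ (\sum_(1 <= N < n.+1) K)).
  by apply: ler_sum => N _; apply: hK; exact: tent_iter_I01.
by rewrite sumr_const_nat subn1 /= mulr_natl.
Qed.

Theorem theorem1p7 (R : realType) (r : R) (hr0 : 0 < `|r|) (hr1 : `|r| < 1) :
  (exists L : R -> R,
      measurable_fun (I01 R) L /\
      ~ (exists c : R, {ae @lebesgue_measure R,
                          forall x, (I01 R) x -> L x = c}) /\
      (@lebesgue_measure R).-integrable (I01 R) (EFin \o L) /\
      ((\int[@lebesgue_measure R]_(x in (I01 R)) (L x)%:E)%E = 1%E) /\
      cvg_in_distribution01 (normalized_tail r) L) /\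
  ({ae @lebesgue_measure R, forall x, (I01 R) x ->
      cesaro_tail r N' x @[N' --> \oo] --> (1 : R)} /\
   (\int[@lebesgue_measure R]_(x in (I01 R))
        (`|cesaro_tail r N' x - 1|)%:E)%E @[N' --> \oo] --> 0%E).
Proof.
have bL := bmeas_tail_limit hr1.
have FF := ae_filter_ringOfSetsType (@lebesgue_measure R).
have hae : {ae @lebesgue_measure R, forall x, (I01 R) x ->
      cesaro_tail r N' x @[N' --> \oo] --> (1 : R)}.
  by have := ae_avg_centered R; apply: filterS => x hx Ix; exact: cvg_cesaro_tail (hx Ix).
split.
  exists (tail_limit r); split; first by apply: measurable_funTS; case: bL.
  split; first exact: tail_limit_not_ae_cst.
  split; first exact: bmeas_integrable.
  split; first by rewrite mean_EFin// mean_tail_limit.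
  exact: cvg_distribution_tail.
split; first exact: hae.
(* For convergence in L^1, the constant [K] dominates all averages and is integrable on the unit
   interval. *)
have [K hK] := cesaro_tail_bounded hr0 hr1.
have mI : measurable (I01 R : set (measurableTypeR R)) := @measurable_I01 R.
have mc n : measurable_fun (I01 R : set (measurableTypeR R))
    (EFin \o cesaro_tail r n).
  by apply/measurable_EFinP; apply: measurable_funTS; case: (bmeas_cesaro_tail n hr0 hr1).
have m1 : measurable_fun (I01 R : set (measurableTypeR R)) (EFin \o cst (1 : R)).
  by apply/measurable_EFinP; apply: measurable_funTS; exact: measurable_cst.
have cae : {ae @lebesgue_measure R, forall x, I01 R x ->
    (EFin \o cesaro_tail r n) x @[n --> \oo] --> (EFin \o cst (1 : R)) x}.
  by move: hae; apply: filterS => x hx Ix; apply: cvg_EFin; [exact: nearW|exact: hx].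
have iK := bmeas_integrable (bmeas_cst K).
have dom : {ae @lebesgue_measure R, forall x n, I01 R x ->
    (`|(EFin \o cesaro_tail r n) x| <= (EFin \o fun=> K) x)%E}.
  by apply: aeW => x n Ix; rewrite /= lee_fin; exact: hK.
by have [] := dominated_convergence mI mc m1 cae iK dom.
Qed.
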